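(* Let $\mathcal{A}_1\subsetneq\mathcal{A}_2\subsetneq\dots\subsetneq\mathcal{A}_m\subseteq \mathsf{M}_n(\mathbb{C})$ be a chain of semisimple subalgebras of the algebra $\mathsf{M}_n(\mathbb{C})$ of all complex $n\times n$ matrices, each strictly contained in the next. Then $m\le 2n$. *)

(* Defs.v *)
From HB Require Import structures.
From mathcomp Require Import all_boot all_order all_algebra.
From mathcomp Require Import complex.
From mathcomp Require Import reals.

Set Implicit Arguments.
Unset Strict Implicit.
Unset Printing Implicit Defensive.

Import GRing.Theory.
Local Open Scope ring_scope.

Section Algebras.

Variables (F : fieldType) (n : nat).
Implicit Types A L M : {vspace 'M[F]_n}.

(* A subalgebra need not contain the identity matrix, nor have an identity
   element of its own; the zero subspace is a subalgebra. *)
Definition subalgebra A : Prop :=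
  forall a b : 'M[F]_n, a \in A -> b \in A -> a *m b \in A.

Definition left_ideal A L : Prop :=
  (L <= A)%VS /\ forall a x : 'M[F]_n, a \in A -> x \in L -> a *m x \in L.

(* L is modular (or regular) if A has a right identity modulo L. When A has an
   identity element, every left ideal of A is modular. *)
Definition modular A L : Prop :=
  exists2 e : 'M[F]_n, e \in A & forall a, a \in A -> a - a *m e \in L.

Definition maximal_left_ideal A L : Prop :=
  [/\ left_ideal A L, L <> A &
      forall M, left_ideal A M -> (L <= M)%VS -> M = L \/ M = A].

(* The Jacobson radical of an algebra that may lack an identity element: the
   intersection of its maximal modular left ideals, which is A itself if there
   are none. *)
Definition in_jacobson_radical A (x : 'M[F]_n) : Prop :=
  x \in A /\ forall L, maximal_left_ideal A L -> modular A L -> x \in L.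

Definition semisimple A : Prop :=
  forall x : 'M[F]_n, in_jacobson_radical A x -> x = 0.

End Algebras.

(* Main.v *)
(* Over an algebraically closed field a semisimple algebra [A] with [r] matrix
   blocks has a complete system of orthogonal primitive idempotents [e_i], and
   [r] is the number of classes of the equivalence relation [e_i A e_j <> 0];
   each [e_i A e_j] has dimension at most 1.  If [A] is strictly
   contained in a semisimple [B], then splitting the [e_i] and [1_B - 1_A] in [B]
   gives such a system for [B].  Sending each [e_i] to a suitable summand preserves
   the relation, so the number of classes grows by at most the number of new
   idempotents.  If no idempotent is new and no classes merge, then
   [e_i A e_j = e_i B e_j] for all [i, j] and [A = B].  Hence
   [2 #|idempotents| - #|classes|] is strictly increasing along the chain; it is
   nonnegative, and at most [2n - 1] because [M_n] has no more than [n] nonzero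
   orthogonal idempotents. *)
Require Import Defs.
From HB Require Import structures.
From mathcomp Require Import all_boot all_order all_algebra.
From mathcomp Require Import complex.
From mathcomp Require Import reals boolp zify.

Set Implicit Arguments.
Unset Strict Implicit.
Unset Printing Implicit Defensive.

Import GRing.Theory.
Local Open Scope ring_scope.

(** * Nilpotent elements, nil left ideals and idempotents of matrix algebras *)

Definition nilpotent_elt (R : pzRingType) (x : R) := exists k, x ^+ k = 0.

Lemma nilpotent_elt_mulC (R : pzRingType) (x y : R) :
  nilpotent_elt (x * y) -> nilpotent_elt (y * x).
Proof.
case=> k xyk0; exists k.+1.
have E j : (y * x) ^+ j.+1 = y * (x * y) ^+ j * x.
  elim: j => [|j IHj]; first by rewrite expr1 expr0 mulr1.
  by rewrite exprS IHj [(x * y) ^+ j.+1]exprS !mulrA.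
by rewrite E xyk0 mulr0 mul0r.
Qed.

Section MatrixAlgebras.

Variables (F : fieldType) (n : nat).
Implicit Types (A B : {vspace 'M[F]_n.+1}) (a b e f g x y : 'M[F]_n.+1).

(** The only consequence of semisimplicity that the later arguments rely on. *)
Definition no_nil_ideal A :=
  forall x, x \in A -> x != 0 -> exists2 a, a \in A & ~ nilpotent_elt (a * x).

(** Otherwise maximality gives [L + N = A], and the right identity [e] modulo [L] is [l + x] with
    [x] in [N]. Then [x] and all its powers are right identities modulo [L]; as [x] is nilpotent,
    [L = A]. *)
Lemma maximal_modular_has_nil A L N :
    maximal_left_ideal A L -> modular A L -> left_ideal A N ->
    (forall x, x \in N -> nilpotent_elt x) ->
  (N <= L)%VS.
Proof.
move=> [[LA Lid] neqLA maxL] [e eA eL] [NA Nid] Nnil.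
have LNid : left_ideal A (L + N)%VS.
  split=> [|a x aA H].
    by rewrite subv_add LA.
  case/memv_addP: H => u uL [v vN ->].
  by rewrite mulmxDr memv_add ?Lid ?Nid.
have [<-|LN] := maxL _ LNid (addvSl L N); first exact: addvSr.
case: neqLA; apply/eqP; rewrite eqEsubv LA /=; apply/subvP=> a aA.
have /memv_addP[l lL [x xN def_e]] : e \in (L + N)%VS by rewrite LN.
have xA := subvP NA _ xN.
have xL b : b \in A -> b - b * x \in L.
  move=> bA; have ->: b - b * x = (b - b *m e) + b *m l.
    by rewrite def_e [l + x]addrC mulmxDr opprD addrA subrK.
  by rewrite rpredD ?eL ?Lid.
have xkA k : a * x ^+ k \in A.
  elim: k => [|k IHk]; first by rewrite expr0 mulr1.
  rewrite exprSr mulrA -[_ * x](subKr (a * x ^+ k)).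
  by apply: rpredB => //; apply: (subvP LA); apply: xL.
have xkL k : a - a * x ^+ k \in L.
  elim: k => [|k IHk]; first by rewrite expr0 mulr1 subrr mem0v.
  rewrite -(subrKA (a * x ^+ k)) rpredD // exprSr mulrA; exact: xL.
by have [k xk0] := Nnil x xN; have := xkL k; rewrite xk0 mulr0 subr0.
Qed.

(** Nil left ideals lie in the radical, hence vanish. Without an identity [x] need not lie in [A x],
    so there are two stages: [A x = 0], and then the line through [x] is itself a nil left ideal. *)
Lemma semisimple_no_nil_ideal A :
  subalgebra A -> semisimple A -> no_nil_ideal A.
Proof.
move=> sA ssA x xA x_neq0.
have nil0 N : left_ideal A N -> (forall y, y \in N -> nilpotent_elt y) ->
    forall y, y \in N -> y = 0.
  move=> Nid Nnil y yN; apply: ssA; split=> [|L maxL modL].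
    by case: Nid => /subvP->.
  exact: (subvP (maximal_modular_has_nil maxL modL Nid Nnil)).
apply: contrapT => nex; case/eqP: x_neq0.
have axnil a : a \in A -> nilpotent_elt (a * x).
  by move=> aA; apply: contrapT => ?; apply: nex; exists a.
have ax0 a : a \in A -> a * x = 0.
  move=> aA; apply: (nil0 (linfun (mulmxr x) @: A)%VS).
  - split=> [|b y bA /memv_imgP[c cA ->]].
      by apply/subvP=> y /memv_imgP[c cA ->]; rewrite lfunE /= sA.
    rewrite lfunE /= mulmxA.
    by apply/memv_imgP; exists (b *m c); rewrite ?sA // lfunE.
  - by move=> y /memv_imgP[c cA ->]; rewrite lfunE /=; apply: axnil.
  - by apply/memv_imgP; exists a; rewrite // lfunE.
apply: (nil0 <[x]>%VS); last exact: memv_line.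
  split=> [|b y bA /vlineP[c ->]]; first by rewrite -memvE.
  by rewrite -scalemxAr -[b *m x]/(b * x) ax0 // scaler0 mem0v.
move=> y /vlineP[c ->]; exists 2%N.
by rewrite exprZn [x ^+ 2]expr2 ax0 // scaler0.
Qed.

(** The factor ['X] removes the constant term, since [A] need not contain [1]. *)
Lemma horner_mxM_mem A y (p : {poly F}) :
  subalgebra A -> y \in A -> horner_mx y (p * 'X) \in A.
Proof.
move=> sA yA; elim/poly_ind: p => [|p c IHp].
  by rewrite mul0r rmorph0 mem0v.
rewrite mulrDl rmorphD rmorphM /= horner_mx_X mul_polyC linearZ /= horner_mx_X.
by rewrite rpredD ?rpredZ ?sA.
Qed.

(* Fitting's lemma: with [char_poly y = q 'X^k], [q.[0] != 0], the Bezout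
   relation between [q] and ['X^k.+2] yields the projection onto the part on
   which [y] is invertible, as a polynomial in [y] without constant term. *)
Lemma nonnil_idempotent A y : subalgebra A -> y \in A -> ~ nilpotent_elt y ->
  exists2 g, [/\ g \in A, g * g = g & g != 0] &
  exists w, g = w * y /\ g = y * w.
Proof.
move=> sA yA ynil.
have [k [q]] := multiplicity_XsubC (char_poly y) 0.
rewrite monic_neq0 ?char_poly_monic //= subr0 => q0 def_p.
have /Bezout_eq1_coprimepP[[u v] /= uv1] : coprimep q ('X^(k.+2)).
  by apply: coprimep_expr; rewrite -['X]subr0 coprimep_XsubC.
have yqk : y ^+ k * horner_mx y q = 0.
  rewrite -[in y ^+ k](horner_mx_X y) -rmorphXn -rmorphM mulrC -def_p.
  exact: Cayley_Hamilton.
have E1 : horner_mx y u * horner_mx y q + horner_mx y (v * 'X^(k.+2)) = 1.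
  by rewrite -rmorphM -rmorphD uv1 rmorph1.
exists (horner_mx y (v * 'X^(k.+2))).
  (* The idempotent is [g = (v 'X^k.+2)(y)]. By Bezout [1 - g = u(y) q(y)], which [y ^+ k] kills by
     Cayley-Hamilton; [y ^+ k] also divides [g], so [g (1 - g) = 0]. *)
  have yg0 : y ^+ k * (1 - horner_mx y (v * 'X^(k.+2))) = 0.
    rewrite -[X in X - _]E1 addrK -rmorphM mulrC rmorphM /= mulrA yqk.
    by rewrite mul0r.
  split; first by rewrite exprSr mulrA horner_mxM_mem.
  - apply/esym/eqP; rewrite -subr_eq0 -{1}[horner_mx _ _]mulr1 -mulrBr.
    have {1}->: v * 'X^(k.+2) = v * 'X^2 * 'X^k by rewrite -mulrA -exprD.
    have yk : horner_mx y 'X^k = y ^+ k by rewrite rmorphXn /= horner_mx_X.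
    by rewrite [X in X * _]rmorphM /= yk -mulrA yg0 mulr0.
  - apply/eqP=> g0; apply: ynil; exists k.
    by rewrite g0 subr0 mulr1 in yg0.
exists (horner_mx y (v * 'X^(k.+1))).
rewrite {1 2}exprSr mulrA; split; first by rewrite rmorphM /= horner_mx_X.
by rewrite mulrC rmorphM /= horner_mx_X.
Qed.

(** With equal ranks the row spaces of [g] and [e] agree, so [e = D g] and [e g = e], against
    [e g = g]. *)
Lemma rank_subidempotent e g : g * g = g ->
  e * g = g -> g * e = g -> g != e -> (\rank g < \rank e)%N.
Proof.
move=> gg eg ge neq; have sge : (g <= e)%MS by rewrite -[g]ge submxMl.
rewrite ltn_neqAle mxrankS // andbT; apply: contra neq => /eqP rk.
have /andP[_ /submxP[D defe]] : (g == e)%MS.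
  by rewrite -(mxrank_leqif_eq sge) rk.
by apply/eqP; rewrite -eg defe -mulrA gg.
Qed.

End MatrixAlgebras.

Lemma nonnil_eigenvalue (F : closedFieldType) (n : nat) (y : 'M[F]_n.+1) :
  ~ nilpotent_elt y -> exists2 c, c != 0 & eigenvalue y c.
Proof.
move=> ynil; have [r] := closed_field_poly_normal (char_poly y).
rewrite (monicP (char_poly_monic y)) scale1r => def_p.
have [/hasP[c cr c0]|/hasPn r0] := boolP (has (fun c => c != 0) r).
  by exists c; rewrite // eigenvalue_root_char def_p root_prod_XsubC.
case: ynil; exists (size r); rewrite -(Cayley_Hamilton y) def_p.
rewrite (eq_big_seq (fun=> 'X)) => [|c /r0]; last first.
  by rewrite negbK => /eqP->; rewrite subr0.
by rewrite big_const_seq count_predT iter_mulr_1 rmorphXn /= horner_mx_X.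
Qed.

(** * Primitive idempotents and the identity element *)

Section Idempotents.

Variables (F : closedFieldType) (n : nat).
Implicit Types (A B : {vspace 'M[F]_n.+1}) (a b e f g x y : 'M[F]_n.+1).

(** In the corner [e A e] a non-nilpotent element is invertible, since its Fitting idempotent must
    be [e], and a nilpotent one is zero. Subtracting an eigenvalue times [e] destroys invertibility,
    hence leaves zero. *)
Lemma indecomposable_scalar A e : subalgebra A -> no_nil_ideal A ->
    e \in A -> e * e = e -> e != 0 ->
    (forall g, g \in A -> g * g = g -> e * g = g -> g * e = g -> g != 0 ->
       g = e) ->
  forall x, x \in A -> exists c, e * x * e = c *: e.
Proof.
move=> sA nniA eA ee e0 prim x xA.
have inv y : y \in A -> e * y = y -> y * e = y -> ~ nilpotent_elt y ->
    exists w, e = w * y /\ e = y * w.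
  move=> yA ey ye /nonnil_idempotent-/(_ _ sA yA)[g [gA gg g0] [w [gw1 gw2]]].
  have <- : g = e; last by exists w.
  by apply: prim; rewrite // ?[in e * _]gw2 ?[in _ * e]gw1 ?mulrA ?ey -?mulrA ?ye.
have nil0 z : z \in A -> e * z = z -> z * e = z -> nilpotent_elt z -> z = 0.
  move=> zA ez ze [k zk0]; apply: contrapT => /eqP z0.
  have [a aA az] := nniA z zA z0.
  have [||||w [def_e _]] := inv (e * a * z); rewrite ?sA ?mulrA ?ee //.
  - by rewrite -[_ * e]mulrA ze.
  - move=> nz; apply: az; rewrite -{1}ze mulrA; apply: nilpotent_elt_mulC.
    by rewrite mulrA.
  (* [t] is a left inverse of [z] relative to [e], so [e] is a multiple of every positive power of
     [z]; nilpotency would force [e = 0]. *)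
  set t := w * e * a; have te : e = t * z by rewrite /t -!mulrA in def_e *.
  have ez_exp j : e * z ^+ j.+1 = z ^+ j.+1 by rewrite exprS mulrA ez.
  have te_exp j : e = t ^+ j.+1 * z ^+ j.+1.
    elim: j => [//|j IHj].
    rewrite [t ^+ _]exprSr [z ^+ j.+2]exprS mulrA -[_ * t * z]mulrA -te.
    by rewrite -mulrA ez_exp.
  by case/eqP: e0; rewrite (te_exp k) [z ^+ k.+1]exprS zk0 !mulr0.
have yA : e * x * e \in A by rewrite !sA.
have ye : e * x * e * e = e * x * e by rewrite -mulrA ee.
have ey : e * (e * x * e) = e * x * e by rewrite !mulrA ee.
move: (e * x * e) yA ye ey => y yA ye ey.
have [/(nil0 y yA ey ye)->|ynil] := pselect (nilpotent_elt y).
  by exists 0; rewrite scale0r.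
have [c c0 /eigenvalueP[v vy v0]] := nonnil_eigenvalue ynil.
exists c; apply/eqP; rewrite -subr_eq0; apply/eqP.
have zA : y - c *: e \in A by rewrite rpredB ?rpredZ.
have ze : (y - c *: e) * e = y - c *: e by rewrite mulrBl ye -scalerAl ee.
have ez : e * (y - c *: e) = y - c *: e by rewrite mulrBr ey -scalerAr ee.
apply: nil0 => //; apply: contrapT => /(inv _ zA ez ze)[w [_ def_e]].
(* The eigenvector is fixed by [e] because [c != 0] and [y e = y]; hence [v = v (y - c e) w = 0]. *)
have ve : v *m e = v.
  apply: (scalerI c0); rewrite scalemxAl -vy -mulmxA.
  by rewrite [y *m e]ye.
case/eqP: v0; rewrite -ve def_e -[_ * w]/(_ *m w) mulmxA mulmxBr vy.
by rewrite -scalemxAr ve subrr mul0mx.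
Qed.

Definition orthogonal_idempotents (I : finType) (f : I -> 'M[F]_n.+1) :=
  forall i j, f i * f j = if i == j then f i else 0.

(** Primitivity is encoded as one-dimensional corners, the form in which it is used for the
    blocks. *)
Definition primitive_family A (I : finType) (f : I -> 'M[F]_n.+1) :=
  [/\ forall i, f i \in A, orthogonal_idempotents f, forall i, f i != 0
    & forall i x, x \in A -> exists c, f i * x * f i = c *: f i].

Lemma mul_orthogonal_sum (I : finType) (f : I -> 'M[F]_n.+1) i :
  orthogonal_idempotents f -> f i * (\sum_j f j) = f i.
Proof.
move=> ort; rewrite mulr_sumr (bigD1 i) //= ort eqxx big1 ?addr0 // => j.
by rewrite ort eq_sym => /negPf->.
Qed.

Lemma orthogonal_sum_mul (I : finType) (f : I -> 'M[F]_n.+1) i :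
  orthogonal_idempotents f -> (\sum_j f j) * f i = f i.
Proof.
move=> ort; rewrite mulr_suml (bigD1 i) //= ort eqxx big1 ?addr0 // => j.
by rewrite ort => /negPf->.
Qed.

(** Induction on the rank: either a proper subidempotent [g] splits [e] into [g] and [e - g], both
    of smaller rank, or [indecomposable_scalar] applies. *)
Lemma idempotent_split A e : subalgebra A -> no_nil_ideal A ->
    e \in A -> e * e = e ->
  exists (I : finType) (f : I -> 'M[F]_n.+1),
    primitive_family A f /\ \sum_i f i = e.
Proof.
move=> sA nniA; have [k] := ubnP (\rank e); elim: k e => // k IHk e rk eA ee.
have [->|e0] := eqVneq e 0.
  by exists void, (fun=> 0); split; [split=> [] [] | rewrite big1].
have [[g [[gA gg eg ge] [g0 gne]]]|noprim] := pselect (exists g,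
    [/\ g \in A, g * g = g, e * g = g & g * e = g] /\ (g != 0 /\ g != e)).
  have [|||I1 [f1 [[f1A ort1 nz1 pr1] sum1]]] := IHk g.
  - by rewrite (leq_trans (rank_subidempotent gg eg ge gne)).
  - by [].
  - by [].
  have hh : (e - g) * (e - g) = e - g.
    by rewrite mulrBl !mulrBr ee eg ge gg subrr subr0.
  have [|||I2 [f2 [[f2A ort2 nz2 pr2] sum2]]] := IHk (e - g).
  - rewrite (leq_trans _ (_ : \rank e <= k)%N) // rank_subidempotent //.
    + by rewrite mulrBr ee eg.
    + by rewrite mulrBl ee ge.
    + by apply: contra g0 => /eqP E; rewrite -(subKr e g) E subrr.
  - by rewrite rpredB.
  - by [].
  have gh : g * (e - g) = 0 by rewrite mulrBr ge gg subrr.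
  have hg : (e - g) * g = 0 by rewrite mulrBl eg gg subrr.
  exists (I1 + I2)%type, (fun i => match i with inl i => f1 i | inr i => f2 i end).
  split; last by rewrite big_sumType /= sum1 sum2 addrC subrK.
  split=> [[]|[i|i] [j|j]|[]|[]] //=; rewrite ?ort1 ?ort2 //=.
    rewrite -(mul_orthogonal_sum i ort1) -(orthogonal_sum_mul j ort2).
    by rewrite sum1 sum2 mulrA -[_ * g * _]mulrA gh mulr0 mul0r.
  rewrite -(mul_orthogonal_sum i ort2) -(orthogonal_sum_mul j ort1).
  by rewrite sum1 sum2 mulrA -[_ * _ * g]mulrA hg mulr0 mul0r.
exists unit, (fun=> e); split; last by rewrite big_const card_unit /= addr0.
split=> // _ x xA.
apply: (indecomposable_scalar sA nniA) => // g gA gg eg ge g0.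
by apply: contrapT => /eqP gne; apply: noprim; exists g.
Qed.

(** While [(1 - u) A (1 - u)] is nonzero, it leads to an idempotent [g] orthogonal to [u], and
    [u + g] has larger rank. Once it is zero, every [x] in [(1 - u) A] or [A (1 - u)] satisfies
    [x A x = 0], so [x = 0] and [u] is the identity. *)
Lemma no_nil_ideal_unit A : subalgebra A -> no_nil_ideal A ->
  exists2 u, u \in A & forall a, a \in A -> u * a = a /\ a * u = a.
Proof.
move=> sA nniA.
suff ext k u : u \in A -> u * u = u -> (n.+1 - \rank u < k)%N ->
    exists2 u, u \in A & forall a, a \in A -> u * a = a /\ a * u = a.
  by apply: (ext (n.+1 - \rank (0 : 'M[F]_n.+1)).+1 0); rewrite ?mem0v ?mul0r.
elim: k u => // k IHk u uA uu rk.
have pp : (1 - u) * (1 - u) = 1 - u.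
  by rewrite mulrBl mul1r mulrBr mulr1 uu subrr subr0.
have up : u * (1 - u) = 0 by rewrite mulrBr mulr1 uu subrr.
have pu : (1 - u) * u = 0 by rewrite mulrBl mul1r uu subrr.
have plA a : a \in A -> (1 - u) * a \in A.
  by move=> aA; rewrite mulrBl mul1r rpredB ?sA.
have prA a : a \in A -> a * (1 - u) \in A.
  by move=> aA; rewrite mulrBr mulr1 rpredB ?sA.
have [[a aA a0]|corner0] :=
    pselect (exists2 a, a \in A & (1 - u) * a * (1 - u) != 0).
  have [x xA [x0 xp]] : exists2 x, x \in A & x != 0 /\ x * (1 - u) = x.
    exists ((1 - u) * a * (1 - u)); first by rewrite prA ?plA.
    by split=> //; rewrite -!mulrA pp.
  have [b bA bx] := nniA x xA x0.
  have [] := @nonnil_idempotent _ _ A ((1 - u) * b * x).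
  - by [].
  - by rewrite sA ?plA.
  - rewrite -mulrA => nz; apply: bx.
    have -> : b * x = b * x * (1 - u) by rewrite -mulrA xp.
    exact: nilpotent_elt_mulC.
  move=> g [gA gg g0] [w [gw1 gw2]].
  have ug : u * g = 0 by rewrite gw2 !mulrA up !mul0r.
  have gu : g * u = 0 by rewrite gw1 -xp -!mulrA pu !mulr0.
  have ss : (u + g) * (u + g) = u + g.
    by rewrite mulrDl !mulrDr uu ug gu gg addr0 add0r.
  apply: (IHk (u + g)); rewrite ?rpredD //.
  have lt_rk : (\rank u < \rank (u + g)%R)%N.
    apply: rank_subidempotent => //; rewrite ?mulrDl ?mulrDr ?uu ?ug ?gu ?addr0 //.
    by apply: contra g0 => /eqP ueq; rewrite -(addKr u g) -ueq addNr.
  rewrite (leq_trans _ (_ : n.+1 - \rank u <= k)%N) // ltn_sub2l //.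
  exact: leq_trans (rank_leq_row (u + g)).
have c0 a : a \in A -> (1 - u) * a * (1 - u) = 0.
  by move=> aA; apply: contrapT => /eqP a0; apply: corner0; exists a.
have nd0 x : x \in A -> (forall a, a \in A -> x * a * x = 0) -> x = 0.
  move=> xA xax; apply: contrapT => /eqP /(nniA x xA)[a aA []].
  by exists 2%N; rewrite expr2 mulrA -[a * x * a]mulrA -[_ * x]mulrA xax ?mulr0.
exists u => // a aA; split; apply/esym/eqP; rewrite -subr_eq0; apply/eqP.
  rewrite -{1}[a]mul1r -mulrBl; apply: nd0; rewrite ?plA // => b bA.
  by rewrite !mulrA -[_ * b]mulrA c0 ?sA // mul0r.
rewrite -{1}[a]mulr1 -mulrBr; apply: nd0; rewrite ?prA // => b bA.
have -> : a * (1 - u) * b * (a * (1 - u)) = a * ((1 - u) * (b * a) * (1 - u)).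
  by rewrite !mulrA.
by rewrite c0 ?sA // mulr0.
Qed.

(** Choose a nonzero entry [(p i, q i)] of each [f i]. Row [p i] of [f i], rescaled, against column
    [q j] of [f j] gives the identity matrix, factored through dimension [n.+1]. *)
Lemma card_orthogonal_idempotents (I : finType) (f : I -> 'M[F]_n.+1) :
  orthogonal_idempotents f -> (forall i, f i != 0) -> (#|I| <= n.+1)%N.
Proof.
move=> ort f0.
have /fin_all_exists[p /fin_all_exists[q fpq0]] i : exists p q, f i p q != 0.
  apply: contrapT => nex; case/eqP: (f0 i); apply/matrixP=> p q.
  by rewrite mxE; apply: contrapT => /eqP fpq0; apply: nex; exists p, q.
pose V := \matrix_(i < #|I|, k < n.+1) let i' := enum_val i in
  (f i' (p i') (q i'))^-1 * f i' (p i') k.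
pose W := \matrix_(k < n.+1, j < #|I|) let j' := enum_val j in f j' k (q j').
apply: (@mulmx1_min _ _ _ V W); apply/matrixP=> i j; rewrite !mxE.
under eq_bigr => k _ do rewrite !mxE -mulrA.
set i' := enum_val i; set j' := enum_val j; rewrite -mulr_sumr.
have := congr1 (fun M : 'M_n.+1 => M (p i') (q j')) (ort i' j').
rewrite mxE => ->; rewrite (inj_eq enum_val_inj).
by rewrite /i' /j'; case: eqVneq => [->|_]; rewrite ?mulVf // mxE mulr0.
Qed.

End Idempotents.

(** * Class counts under an injection compatible with two equivalences *)

Section ClassCounting.

Definition rel_class (T : finType) (r : rel T) (x : T) := [set y | r x y].

Definition nclasses (T : finType) (r : rel T) := #|rel_class r @: T|.

Lemma eq_rel_class (T : finType) (r : rel T) :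
  equivalence_rel r -> forall x y, (rel_class r x == rel_class r y) = r x y.
Proof.
move=> eqr x y; have rr z : r z z by case: (eqr z z z).
apply/eqP/idP => [E|rxy]; last first.
  by apply/setP=> z; rewrite !inE; case: (eqr x y z) => _ ->.
have : y \in rel_class r y by rewrite inE.
by rewrite -E inE.
Qed.

Lemma nclasses_le_card (T : finType) (r : rel T) : (nclasses r <= #|T|)%N.
Proof. exact: leq_imset_card. Qed.

Lemma nclasses_gt0 (T : finType) (r : rel T) :
  (0 < #|T|)%N -> (0 < nclasses r)%N.
Proof.
by case/card_gt0P=> x _; apply/card_gt0P; exists (rel_class r x); apply: imset_f.
Qed.

Variables (I J : finType) (r : rel I) (s : rel J) (al : I -> J).
Hypotheses (eqr : equivalence_rel r) (eqs : equivalence_rel s).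
Hypothesis al_inj : injective al.
Hypothesis (al_rel : forall i i', r i i' -> s (al i) (al i')).

(** The map induced by [al] on classes; the union avoids choosing a representative. *)
Let h (C : {set I}) := \bigcup_(i in C) rel_class s (al i).

Let hE i : h (rel_class r i) = rel_class s (al i).
Proof.
apply/eqP; rewrite eqEsubset; apply/andP; split.
  apply/bigcupsP=> i'; rewrite inE => rii'.
  by have /eqP-> : rel_class s (al i) == rel_class s (al i');
    first by rewrite eq_rel_class ?al_rel.
by apply: (bigcup_sup i) => //; rewrite inE; case: (eqr i i i).
Qed.

Let al_classes : [set rel_class s (al i) | i in I] = h @: (rel_class r @: I).
Proof. by rewrite -imset_comp; apply: eq_imset => i; rewrite /= hE. Qed.

(** Each class of [s] is either [h] of a class of [r] or the class of a point outside the image of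
    [al]. *)
Lemma nclasses_refine : (nclasses s + #|I| <= nclasses r + #|J|)%N.
Proof.
have sub : rel_class s @: J \subset
    h @: (rel_class r @: I) :|: rel_class s @: (~: (al @: I)).
  rewrite -al_classes; apply/subsetP=> _ /imsetP[j _ ->]; rewrite inE.
  have [/imsetP[i _ ->]|jI] := boolP (j \in al @: I).
    by apply/orP; left; apply: imset_f.
  by apply/orP; right; apply: imset_f; rewrite inE.
have cardJ : (#|I| + #|~: (al @: I)| = #|J|)%N.
  by rewrite -(cardsC (al @: I)) card_imset.
rewrite -cardJ addnCA [(#|I| + _)%N]addnC leq_add2r.
apply: leq_trans (subset_leq_card sub) _; apply: leq_trans (leq_card_setU _ _) _.
by rewrite leq_add ?leq_imset_card.
Qed.

(** Here [al] is onto, so [h] maps classes onto classes; equal counts make it injective. *)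
Lemma nclasses_refine_eq : #|I| = #|J| -> nclasses s = nclasses r ->
  forall i i', s (al i) (al i') -> r i i'.
Proof.
move=> eqIJ eqk i i' sii'.
have im_al : al @: I = [set: J].
  by apply/eqP; rewrite eqEcard subsetT cardsT card_imset // eqIJ leqnn.
have h_inj : {in rel_class r @: I &, injective h}.
  apply/imset_injP; rewrite -al_classes -[X in _ == X]eqk; apply/eqP.
  apply: eq_card => C; apply/imsetP/imsetP.
    by case=> k _ ->; exists (al k).
  case=> j _ ->; have /imsetP[k _ ->] : j \in al @: I by rewrite im_al inE.
  by exists k.
rewrite -(eq_rel_class eqr); apply/eqP/h_inj; rewrite ?imset_f // !hE.
by apply/eqP; rewrite eq_rel_class.
Qed.

End ClassCounting.

(** * Complete systems of primitive idempotents and their growth *)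

Section Frames.

Variables (F : closedFieldType) (n : nat).
Implicit Types (A B : {vspace 'M[F]_n.+1}) (a b x y : 'M[F]_n.+1).

Definition frame A (I : finType) (e : I -> 'M[F]_n.+1) :=
  primitive_family A e /\
  forall a, a \in A -> (\sum_i e i) * a = a /\ a * (\sum_i e i) = a.

Lemma frame_exists A : subalgebra A -> no_nil_ideal A ->
  exists (I : finType) (e : I -> 'M[F]_n.+1), frame A e.
Proof.
move=> sA nniA; have [u uA u1] := no_nil_ideal_unit sA nniA.
have [I [e [prim sum_e]]] := idempotent_split sA nniA uA (u1 u uA).1.
by exists I, e; split; rewrite ?sum_e.
Qed.

(* The piece [pi j = None] refines the part of the identity of [B] that lies
   outside that of the algebra carrying [e]. *)
Lemma frame_refine B (I : finType) (e : I -> 'M[F]_n.+1) :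
    subalgebra B -> no_nil_ideal B ->
    (forall i, e i \in B) -> orthogonal_idempotents e ->
  exists (J : finType) (f : J -> 'M[F]_n.+1) (pi : J -> option I),
    frame B f /\ forall i, \sum_(j | pi j == Some i) f j = e i.
Proof.
move=> sB nniB eB ort; have [u uB u1] := no_nil_ideal_unit sB nniB.
pose s := \sum_i e i; have sumB : s \in B by apply: rpred_sum => i _; apply: eB.
have ss : s * s = s.
  by rewrite mulr_suml; apply: eq_bigr => i _; rewrite mul_orthogonal_sum.
have [us su] := u1 s sumB; have [uu _] := u1 u uB.
pose E (o : option I) := if o is Some i then e i else u - s.
have EB o : E o \in B by case: o => [i|] /=; rewrite ?eB ?rpredB.
have Eort : orthogonal_idempotents E.
  move=> [i|] [i'|] /=.
  - exact: ort.
  - by rewrite mulrBr mul_orthogonal_sum ?(u1 _ (eB i)).2 ?subrr.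
  - by rewrite mulrBl orthogonal_sum_mul ?(u1 _ (eB i')).1 ?subrr.
  - by rewrite mulrBl !mulrBr ss us su uu subrr subr0.
have EE o : E o * E o = E o by rewrite Eort eqxx.
have /fin_all_exists[K] := fun o => idempotent_split sB nniB (EB o) (EE o).
move=> /fin_all_exists[f fK].
(* The pieces of all the [E o] are gathered in a dependent sum, whose [tag] serves as [pi]. *)
pose J := {o : option I & K o}; pose g (j : J) := f (tag j) (tagged j).
have sum_tag o : \sum_(j : J | tag j == o) g j = E o.
  have [_ <-] := fK o.
  have := @sig_big_dep _ _ +%R _ K (pred1 o) (fun=> xpredT) f.
  rewrite big_pred1_eq => ->.
  by apply: eq_bigl => j; rewrite andbT.
have sum_g : \sum_j g j = u.
  rewrite (partition_big tag predT) //= (eq_bigr E) => [|o _]; last exact: sum_tag.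
  rewrite (bigD1 None) //= (reindex_omap Some id) => [|[]] //=.
  by rewrite (eq_bigl predT) ?subrK // => i; rewrite eqxx.
exists J, g, tag; split=> [|i]; last exact: sum_tag.
split; last by move=> a aB; rewrite sum_g; apply: u1.
split=> [[o k]|[o k] [o' k']|[o k]|[o k]]; rewrite /g /=;
  have [[fB fort fnz fpr] fsum] := fK o => //;
  last exact: fpr.
have [[_ fort' _ _] fsum'] := fK o'.
have [eqo|neo] := eqVneq o o'.
  case: _ / eqo k' {fort' fsum'} => k'.
  by rewrite fort -tag_eqE /tag_eq /= eqxx tagged_asE.
rewrite -tag_eqE /tag_eq /= (negPf neo) /=.
rewrite -(mul_orthogonal_sum k fort) -(orthogonal_sum_mul k' fort') fsum fsum'.
by rewrite mulrA -[_ * E o * _]mulrA Eort (negPf neo) mulr0 mul0r.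
Qed.

(** For a frame this says that [e i] and [e j] lie in the same matrix block. *)
Definition linked A (I : Type) (e : I -> 'M[F]_n.+1) (i j : I) : bool :=
  `[< exists2 a, a \in A & e i * a * e j != 0 >].

Section Linked.

Variables (A : {vspace 'M[F]_n.+1}) (I : finType) (e : I -> 'M[F]_n.+1).
Hypotheses (sA : subalgebra A) (nniA : no_nil_ideal A).
Hypothesis (prim : primitive_family A e).

(** With [y = e i * x * e j], some [a y] is not nilpotent, so [e j * a * y] is a nonzero multiple of
    [e j]; rescaling [a] inverts [y] on the left. The opposite product is [d *: e i], and
    [d *: y = y] gives [d = 1]. *)
Lemma linked_inverse i j x : x \in A -> e i * x * e j != 0 ->
  exists2 a, a \in A & (e i * x * e j) * (e j * a * e i) = e i
                    /\ (e j * a * e i) * (e i * x * e j) = e j.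
Proof.
have [eA ort nz pr] := prim => xA x0.
have ee k : e k * e k = e k by rewrite ort eqxx.
move def_y: (e i * x * e j) x0 => y x0.
have yA : y \in A by rewrite -def_y !sA.
have ey : e i * y = y by rewrite -def_y !mulrA ee.
have ye : y * e j = y by rewrite -def_y -mulrA ee.
have [a aA ay] := nniA yA x0.
have [c jaj] := pr j (a * y) (sA aA yA).
have jay : e j * (a * y) = c *: e j by rewrite -jaj -!mulrA ye.
have c0 : c != 0.
  apply/eqP=> c0; apply: ay; rewrite -ye mulrA; apply: nilpotent_elt_mulC.
  by exists 1%N; rewrite expr1 jay c0 scale0r.
exists (c^-1 *: a); first exact: rpredZ.
have inv_l : e j * (c^-1 *: a) * e i * y = e j.
  by rewrite -mulrA ey -scalerAr -scalerAl -mulrA jay scalerA mulVf ?scale1r.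
split=> //; have [|d] := pr i (y * e j * (c^-1 *: a)); first by rewrite !sA ?rpredZ.
move=> def_d; have {}def_d : y * (e j * (c^-1 *: a) * e i) = d *: e i.
  by rewrite -def_d !mulrA ey.
rewrite def_d.
have : d *: y = y.
  by rewrite -{1}ey scalerAl -def_d -[LHS]mulrA inv_l ye.
move/eqP; rewrite -subr_eq0 -{2}[y]scale1r -scalerBl scaler_eq0 (negPf x0).
by rewrite orbF subr_eq0 => /eqP->; rewrite scale1r.
Qed.

Lemma linked_equiv : equivalence_rel (linked A e).
Proof.
have [eA ort nz pr] := prim; have ee k : e k * e k = e k by rewrite ort eqxx.
have sym i j : linked A e i j -> linked A e j i.
  move=> /asboolP[x xA x0]; have [a aA [inv _]] := linked_inverse xA x0.
  apply/asboolP; exists a => //; apply: contra (nz i) => /eqP a0.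
  by rewrite -inv a0 mulr0.
have trans i j k : linked A e i j -> linked A e j k -> linked A e i k.
  move=> /asboolP[x xA x0] /asboolP[y yA y0].
  have [a aA [_ inv]] := linked_inverse xA x0.
  apply/asboolP; exists (x * e j * y); first by rewrite !sA.
  apply: contra y0 => /eqP xy0.
  have : e j * a * e i * (e i * (x * e j * y) * e k) = e j * y * e k.
    by rewrite -[in RHS]inv !mulrA.
  by rewrite xy0 mulr0 => <-.
move=> i j k; split; first by apply/asboolP; exists (e k); rewrite ?eA ?ee ?nz.
by move=> ij; apply/idP/idP; [apply: trans; apply: sym | apply: trans].
Qed.

(** Inserting the inverse of [e i * x * e j] leaves a factor in the scalar corner [e i A e i]. *)
Lemma linked_dim1 i j x y : x \in A -> y \in A -> e i * x * e j != 0 ->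
  exists c, e i * y * e j = c *: (e i * x * e j).
Proof.
have [eA ort nz pr] := prim; have ee k : e k * e k = e k by rewrite ort eqxx.
move=> xA yA x0; have [a aA [_ inv]] := linked_inverse xA x0.
have [c def_c] := pr i (y * e j * a) (sA (sA yA (eA j)) aA).
exists c; rewrite -[in LHS]inv !mulrA.
by rewrite !mulrA in def_c; rewrite def_c -!scalerAl ee.
Qed.

End Linked.

Lemma frame_step A B (I : finType) (e : I -> 'M[F]_n.+1) :
    subalgebra A -> no_nil_ideal A -> subalgebra B -> no_nil_ideal B ->
    frame A e -> (A <= B)%VS -> A <> B ->
  exists (J : finType) (f : J -> 'M[F]_n.+1), frame B f /\
    (#|I|.*2 + nclasses (linked B f) < #|J|.*2 + nclasses (linked A e))%N.
Proof.
move=> sA nniA sB nniB [prA unitA] AB neqAB; have [eA ort nz pr] := prA.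
have ee k : e k * e k = e k by rewrite ort eqxx.
have [] := @frame_refine B I e sB nniB; [|by []|].
  by move=> i; apply: (subvP AB).
move=> J [f [pi [frB sum_f]]]; exists J, f; split=> //.
have [prB unitB] := frB; have [fB fort fnz fpr] := prB.
have eqA := linked_equiv sA nniA prA; have eqB := linked_equiv sB nniB prB.
have fe j i : pi j = Some i -> f j * e i = f j.
  move=> pij; rewrite -sum_f mulr_sumr (bigD1 j) /= ?pij // fort eqxx.
  rewrite big1 ?addr0 // => k /andP[_ kj]; by rewrite fort eq_sym (negPf kj).
have /fin_all_exists[be pi_be] i : exists j, pi j = Some i.
  apply: contrapT => nex; case/eqP: (nz i); rewrite -sum_f big1 // => j /eqP pij.
  by case: nex; exists j.
(* A canonical class representative: [pick] depends only on the predicate, hence on the class.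
   Reflexivity keeps the default from being reached. *)
pose rep i := odflt i [pick k | linked A e i k].
have rep_linked i : linked A e i (rep i).
  by rewrite /rep; case: pickP => //= _; case: (eqA i i i).
have rep_eq i i' : linked A e i i' -> rep i = rep i'.
  move=> ii'; rewrite /rep.
  have E : linked A e i =1 linked A e i' by move=> k; case: (eqA i i' k) => _ ->.
  rewrite (eq_pick E); case: pickP => //= /(_ i'); by case: (eqA i' i' i') => ->.
(* [al i] is a piece of [e i] in the [B]-block of one fixed piece of [e (rep i)], so linked indices
   have linked images. It exists because [f b * x * e i] is nonzero and [e i] is the sum of its
   pieces. *)
have /fin_all_exists[al al_spec] i :
    exists j, pi j = Some i /\ linked B f (be (rep i)) j.
  have /asboolP[x xA x0] : linked A e (rep i) i.
    by case: (eqA i (rep i) i) => rr /(_ (rep_linked i)) <-; case: (eqA i i i).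
  have [a aA [inv _]] := linked_inverse sA nniA prA xA x0.
  set b := be (rep i).
  have fx0 : f b * x * e i != 0.
    apply: contra (fnz b) => /eqP fx0; rewrite -(fe b (rep i)) ?pi_be // -inv.
    by rewrite !mulrA fe ?pi_be // fx0 !mul0r.
  apply: contrapT => nex; case/eqP: fx0; rewrite -sum_f mulr_sumr big1 // => j /eqP pij.
  apply: contrapT => /eqP fxj; apply: nex; exists j; split=> //.
  by apply/asboolP; exists x => //; apply: (subvP AB).
have al_inj : injective al.
  move=> i i' E; have [] := al_spec i; rewrite E; have [-> _] := al_spec i'.
  by case.
have al_rel i i' : linked A e i i' -> linked B f (al i) (al i').
  move=> /rep_eq E; have [_ l1] := al_spec i; have [_] := al_spec i'.
  by rewrite -E; have [_ ->] := eqB (be (rep i)) (al i) (al i').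
have le1 := nclasses_refine eqA eqB al_inj al_rel.
have le2 := leq_card al al_inj.
(* If the measure does not grow, both counts are unchanged: no [e i] splits, and no classes
   merge. *)
rewrite ltnNge; apply/negP=> le3; apply: neqAB.
have cIJ : #|I| = #|J| by move: le1 le2 le3; rewrite -!addnn; lia.
have kIJ : nclasses (linked B f) = nclasses (linked A e).
  by move: le1 le2 le3; rewrite -!addnn; lia.
have back := nclasses_refine_eq eqA eqB al_inj al_rel cIJ kIJ.
have [al' alK al'K] : bijective al by apply: inj_card_bij; rewrite ?cIJ.
have fal i : f (al i) = e i.
  rewrite -sum_f (big_pred1 (al i)) // => j /=; apply/eqP/eqP => [pij|->].
    by rewrite -[j]al'K; congr al; have [] := al_spec (al' j); rewrite al'K pij => -[].
  by have [] := al_spec i.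
have sum_ef : \sum_j f j = \sum_i e i.
  by rewrite (reindex al) /=; [apply: eq_bigr => i _; rewrite fal | exists al' => ? _].
apply/eqP; rewrite eqEsubv AB; apply/subvP=> b bB.
have <- : (\sum_i e i) * b * (\sum_i e i) = b.
  by have [ub bu] := unitB b bB; rewrite -sum_ef ub bu.
rewrite !mulr_suml.
apply: rpred_sum => i _; rewrite mulr_sumr; apply: rpred_sum => i' _.
have [->|b0] := eqVneq (e i * b * e i') 0; first exact: mem0v.
(* As no classes merged, [e i A e i'] is nonzero; it therefore fills the one-dimensional
   [e i B e i'], which puts [e i * b * e i'] in [A]. *)
have /back/asboolP[a aA a0] : linked B f (al i) (al i').
  by apply/asboolP; exists b; rewrite ?fal.
have a0' : f (al i) * a * f (al i') != 0 by rewrite !fal.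
have [c] := linked_dim1 sB nniB prB (subvP AB _ aA) bB a0'.
by rewrite !fal => ->; rewrite rpredZ ?sA.
Qed.

End Frames.

(** * The bound on the length of the chain *)

Theorem theorem5 (R : realType) (n m : nat) (hn : (0 < n)%N)
    (A : 'I_m -> {vspace 'M[complex R]_n})
    (hsub : forall i : 'I_m, subalgebra (A i))
    (hss : forall i : 'I_m, semisimple (A i))
    (hchain : forall i j : 'I_m, nat_of_ord j = (nat_of_ord i).+1 ->
       (A i <= A j)%VS /\ A i <> A j) :
  (m <= 2 * n)%N.
Proof.
case: n hn A hsub hss hchain => // n' _ A sA ssA chainA.
have nniA i := semisimple_no_nil_ideal (sA i) (ssA i).
have frames k (hk : (k < m)%N) :
  exists (I : finType) (e : I -> 'M[complex R]_n'.+1),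
    frame (A (Ordinal hk)) e /\
    (k + nclasses (linked (A (Ordinal hk)) e) <= #|I|.*2)%N.
  elim: k hk => [|k IHk] hk.
    have [I [e fr]] := frame_exists (sA (Ordinal hk)) (nniA (Ordinal hk)).
    exists I, e; split=> //.
    by rewrite add0n -addnn (leq_trans (nclasses_le_card _)) ?leq_addr.
  have [I [e [fr le_k]]] := IHk (ltnW hk).
  have [sub neq] := chainA (Ordinal (ltnW hk)) (Ordinal hk) erefl.
  have [J [f [frf lt_f]]] :=
    frame_step (sA _) (nniA _) (sA _) (nniA _) fr sub neq.
  by exists J, f; split=> //; lia.
case: m A sA ssA chainA nniA frames => // m' A _ _ _ _ frames.
have [I [e [[[_ ort nz _] _] le_m]]] := frames m' (ltnSn m').
have := card_orthogonal_idempotents ort nz.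
(* The last index is [m - 1], and a class supplies the missing unit. If [I] is empty there is none,
   but then [m = 1]. *)
by have := @nclasses_gt0 I (linked (A (Ordinal (ltnSn m'))) e); lia.
Qed.
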